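(* Let $n\ge 1$ and $m\ge 0$ be integers, let $a$ be an indeterminate (or a complex number for which the denominators below are nonzero), and put $b=a-m$, so that $a-b=m$. Let $$D_n(a,b)=\left[\binom{2i+2a}{i-j+a-b}-\binom{2i+2a}{i-j+a-b-1}\right]_{i,j=0}^{n-1}.$$ Then $$\det D_n(a,b)=\prod_{i=1}^n\prod_{j=1}^{a-b}\frac{(a+b+i-j)(a+b+2i+j-2)}{(a+b+2i-j)(i+j-1)}.$$
   Context: For $z$ an indeterminate or complex number and $k$ an integer, $\binom{z}{k}=z(z-1)\cdots(z-k+1)/k!$ if $k\ge 0$ and $\binom{z}{k}=0$ if $k<0$. The identity is understood as an identity of rational functions in $a$ when $a$ is an indeterminate. *)

(* Defs.v *)
From HB Require Import structures.
From mathcomp Require Import all_boot all_order all_algebra.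
From mathcomp Require Import complex reals.

Set Implicit Arguments.
Unset Strict Implicit.
Unset Printing Implicit Defensive.

Import GRing.Theory.
Local Open Scope ring_scope.

Definition gbinom (F : fieldType) (z : F) (k : int) : F :=
  match k with
  | Posz k' => (\prod_(0 <= t < k') (z - t%:R)) / (k'`!)%:R
  | Negz _ => 0
  end.

(* D_n(a, b) for b = a - m: the lower index i - j + a - b of the binomial
   coefficients is the integer i - j + m, so the matrix takes m instead of b. *)
Definition Dmx (F : fieldType) (n m : nat) (a : F) : 'M[F]_n :=
  \matrix_(i < n, j < n)
    (gbinom (2 * i%:R + 2 * a) (i%:Z - j%:Z + m%:Z)
     - gbinom (2 * i%:R + 2 * a) (i%:Z - j%:Z + m%:Z - 1)).

Definition factor_num (F : fieldType) (a b : F) (i j : nat) : F :=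
  (a + b + i%:R - j%:R) * (a + b + 2 * i%:R + j%:R - 2).

Definition factor_den (F : fieldType) (a b : F) (i j : nat) : F :=
  (a + b + 2 * i%:R - j%:R) * (i%:R + j%:R - 1).

Definition det_formula (F : fieldType) (n m : nat) (a : F) : Prop :=
  let b := a - m%:R in
  \det (Dmx n m a) =
    \prod_(1 <= i < n.+1) \prod_(1 <= j < m.+1)
      (factor_num a b i j / factor_den a b i j).

Definition ratfun_var (K : fieldType) : {fraction {poly K}} :=
  tofrac ('X : {poly K}).

(* Main.v *)
Require Import Defs.
From HB Require Import structures.
From mathcomp Require Import all_boot all_order all_algebra.
From mathcomp Require Import complex reals.
From mathcomp Require Import zify ring.

Set Implicit Arguments.
Unset Strict Implicit.
Unset Printing Implicit Defensive.

Import GRing.Theory.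
Local Open Scope ring_scope.

(** Both sides are rational functions of [a], so it suffices to treat
    [a = v + m] with [v] a natural number. Writing [w = 2 v], the [(i, j)] entry
    is then
      [(w + 2m + 2i)! / ((i + m)! (w + m + i + n)!) * p_j(i + m) * (w + 2j + 1)],
      [p_j(X) = \prod_(s < j) (X - s) * \prod_(j < t < n) (X + w + 1 + t)].
    The polynomials [p_j] have degree [n - 1], so [det (p_j(i + m))] is a
    Vandermonde determinant in the points [i + m] times the determinant of the
    coefficients of the [p_j]; it is therefore invariant under translation of
    the points and equals [det (p_j(i))], which is triangular. The resulting
    product of factorials is rearranged with
    [\prod_(i < n) f(i) f(i + n) = \prod_(i < n) f(2i) f(2i + 1)]. *)

(** * Evaluation matrices and Vandermonde determinants *)

Section PolynomialEvaluationDeterminant.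
Variable F : comNzRingType.

Lemma det_horner (n : nat) (p : 'I_n -> {poly F}) (x : 'rV[F]_n) :
  (forall j, size (p j) <= n)%N ->
  \det (\matrix_(i < n, j < n) (p j).[x 0 i]) =
    \det (Vandermonde n x) * \det (\matrix_(k < n, j < n) (p j)`_k).
Proof.
move=> sz_p; rewrite -(det_tr (Vandermonde n x)) -det_mulmx; congr (\det _).
apply/matrixP=> i j; rewrite !mxE (horner_coef_wide _ (sz_p j)).
by apply: eq_bigr => k _; rewrite !mxE mulrC.
Qed.

(** The Vandermonde factor in [det_horner] is a product of differences of points, in which [c]
    cancels; the coefficient factor does not involve the points. *)
Lemma det_horner_translate (n : nat) (p : 'I_n -> {poly F}) (x : 'rV[F]_n)
    (c : F) :
  (forall j, size (p j) <= n)%N ->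
  \det (\matrix_(i < n, j < n) (p j).[x 0 i + c]) =
    \det (\matrix_(i < n, j < n) (p j).[x 0 i]).
Proof.
move=> sz_p; rewrite (det_horner _ sz_p).
have -> : (\matrix_(i < n, j < n) (p j).[x 0 i + c]) =
  \matrix_(i < n, j < n) (p j).[(x + const_mx c) 0 i].
  by apply/matrixP=> i j; rewrite !mxE.
rewrite (det_horner _ sz_p) !det_Vandermonde; congr (_ * _).
apply: eq_bigr => i _; apply: eq_bigr => j _.
by rewrite !mxE opprD addrACA subrr addr0.
Qed.

End PolynomialEvaluationDeterminant.

(** Both sides multiply [f] over [0 <= i < 2n], grouped by halves on the left and by consecutive
    pairs on the right. *)
Lemma prod_double_range (F : comNzRingType) (n : nat) (f : nat -> F) :
  \prod_(0 <= i < n) (f i * f (i + n)%N) =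
    \prod_(0 <= i < n) (f i.*2 * f i.*2.+1).
Proof.
transitivity (\prod_(0 <= i < n.*2) f i).
  rewrite -addnn [RHS](@big_cat_nat _ _ _ n) ?leq_addr //= big_split /=; congr (_ * _).
  by rewrite -{3}[n]add0n big_addn addnK.
elim: n => [|n IHn]; first by rewrite !big_geq.
by rewrite doubleS !big_nat_recr ?leq0n //= IHn mulrA.
Qed.

(** * The formula for [a = v + m] with [v] a natural number *)

Section NaturalParameter.
Variable F : numFieldType.

Lemma natr_fact_neq0 (k : nat) : k`!%:R != 0 :> F.
Proof. by rewrite Num.Theory.pnatr_eq0 -lt0n fact_gt0. Qed.

Lemma prod_nat_shift (c l k : nat) :
  \prod_(l <= t < k + l) (c + t).+1%:R = (c + l + k)`!%:R / (c + l)`!%:R :> F.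
Proof.
elim: k => [|k IHk]; first by rewrite big_geq // addn0 divff ?natr_fact_neq0.
rewrite addSn big_nat_recr ?leq_addl //= IHk addnS factS natrM.
have -> : (c + (k + l) = c + l + k)%N by lia.
by rewrite mulrC mulrA.
Qed.

Lemma prod_nat_sub (k l : nat) :
  \prod_(0 <= t < k) ((k + l)%:R - t%:R) = (k + l)`!%:R / l`!%:R :> F.
Proof.
have := prod_nat_shift 0 l k; rewrite add0n [(l + k)%N]addnC => <-.
rewrite -{2}[l]add0n big_addn addnK.
rewrite big_nat_rev /= big_nat [RHS]big_nat; apply: eq_bigr => t /andP[_ ltk].
rewrite -natrB; last by lia.
by congr _%:R; lia.
Qed.

(** The factor [t = l] vanishes. This accounts both for the zero entries of [Dmx] with [i + m < j]
    and for the triangularity of [p_j(i)]. *)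
Lemma prod_nat_sub_eq0 (k l : nat) :
  (l < k)%N -> \prod_(0 <= t < k) (l%:R - t%:R) = 0 :> F.
Proof.
move=> ltlk; rewrite big_mkord (bigD1 (Ordinal ltlk)) //=.
by rewrite subrr mul0r.
Qed.

Lemma gbinom_nat (k l : nat) :
  gbinom ((k + l)%:R : F) k = (k + l)`!%:R / (k`!%:R * l`!%:R).
Proof. by rewrite /gbinom prod_nat_sub invfM mulrA mulrAC. Qed.

Lemma gbinom_nat_sub_pred (k l : nat) :
  gbinom ((k + l)%:R : F) k - gbinom ((k + l)%:R : F) (k%:Z - 1) =
    (l.+1%:R - k%:R) * (k + l)`!%:R / (k`!%:R * l.+1`!%:R).
Proof.
have fl := natr_fact_neq0 l; have ll : l.+1%:R != 0 :> F.
  by rewrite Num.Theory.pnatr_eq0.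
rewrite gbinom_nat; case: k => [|k].
  (* For [k = 0] the second lower index is [-1], where [gbinom] is 0 by convention. *)
  rewrite add0n fact0 /gbinom /= subr0 subr0 factS natrM.
  by field; rewrite fl nat1r ll.
have -> : (k.+1%:Z - 1 = k)%R by lia.
have fk := natr_fact_neq0 k; have kk : k.+1%:R != 0 :> F.
  by rewrite Num.Theory.pnatr_eq0.
rewrite addSnnS gbinom_nat !factS !natrM; field.
by rewrite !nat1r fl ll fk kk.
Qed.

(** At [X = l = i + m], the first product turns [1 / l!] into [1 / (l - j)!] and the second turns
    [1 / (w + l + n)!] into [1 / (w + l + j + 1)!], so the remaining row factor is free of [j]. *)
Definition ballot_poly (n w j : nat) : {poly F} :=
  \prod_(0 <= s < j) ('X - s%:R%:P) *
  \prod_(j.+1 <= t < n) ('X - (- (w + t).+1%:R)%:P).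

Lemma size_ballot_poly (n w j : nat) :
  (j < n)%N -> (size (ballot_poly n w j) <= n)%N.
Proof.
move=> ltjn; rewrite /ballot_poly; apply: leq_trans (size_polyMleq _ _) _.
by rewrite !size_prod_XsubC !size_iota; lia.
Qed.

(** The first product stays unevaluated so that [l < j], where it is 0, is covered too. *)
Lemma horner_ballot_poly (n w j l : nat) : (j < n)%N ->
  (ballot_poly n w j).[l%:R] =
    \prod_(0 <= s < j) (l%:R - s%:R) *
    ((w + l + n)`!%:R / (w + l + j).+1`!%:R).
Proof.
move=> ltjn; rewrite /ballot_poly hornerM !horner_prod; congr (_ * _).
  by apply: eq_bigr => s _; rewrite hornerXsubC.
have -> : (w + l + n = w + l + j.+1 + (n - j.+1))%N by lia.
rewrite -addnS -prod_nat_shift subnK //.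
apply: eq_bigr => t _; rewrite hornerXsubC opprK -natrD; congr _%:R; lia.
Qed.

Lemma Dmx_entry_nat (n m v : nat) (i j : 'I_n) :
  Dmx n m (v + m)%:R i j =
    (v.*2 + m.*2 + i.*2)`!%:R / ((i + m)`!%:R * (v.*2 + m + i + n)`!%:R) *
    ((ballot_poly n v.*2 j).[(i + m)%:R] * (v.*2 + j.*2).+1%:R) :> F.
Proof.
rewrite mxE horner_ballot_poly //.
have -> : 2 * i%:R + 2 * (v + m)%:R = (v.*2 + m.*2 + i.*2)%:R :> F.
  by rewrite -!natrM -natrD; congr _%:R; lia.
have [lt_im_j|le_j_im] := ltnP (i + m) j.
  (* Here both lower indices are negative, and [i + m] is a root of [p_j]. *)
  rewrite prod_nat_sub_eq0 // !mul0r mulr0.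
  have gb0 (z : F) (k : int) : (k < 0)%R -> gbinom z k = 0 by case: k.
  by rewrite !gb0 ?subr0 //; lia.
have [k def_k] : {k | i + m = k + j}%N by exists (i + m - j)%N; rewrite subnK.
have -> : i%:Z - j%:Z + m%:Z = k by lia.
have -> : (v.*2 + m.*2 + i.*2 = k + (v.*2 + m + i + j))%N by lia.
rewrite gbinom_nat_sub_pred def_k [X in \prod_(0 <= s < j) (X%:R - _)]addnC.
rewrite prod_nat_sub [(j + k)%N]addnC -def_k.
have -> : (v.*2 + (i + m) + n = v.*2 + m + i + n)%N by lia.
have -> : (v.*2 + (i + m) + j = v.*2 + m + i + j)%N by lia.
rewrite -natrB; last by lia.
(* This factor of the binomial difference is free of [i], hence a column factor. *)
have -> : ((v.*2 + m + i + j).+1 - k = (v.*2 + j.*2).+1)%N by lia.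
by field; rewrite !natr_fact_neq0.
Qed.

Lemma det_Dmx_nat (n m v : nat) :
  \det (Dmx n m ((v + m)%:R : F)) =
    \prod_(0 <= i < n)
      ((v.*2 + m.*2 + i.*2)`!%:R / ((i + m)`!%:R * (v.*2 + m + i + n)`!%:R) *
       (i`!%:R * (v.*2 + i + n)`!%:R / (v.*2 + i.*2)`!%:R)).
Proof.
pose r : 'rV[F]_n := \row_(i < n)
  ((v.*2 + m.*2 + i.*2)`!%:R / ((i + m)`!%:R * (v.*2 + m + i + n)`!%:R)).
pose c : 'rV[F]_n := \row_(j < n) (v.*2 + j.*2).+1%:R.
pose x : 'rV[F]_n := \row_(i < n) i%:R.
pose p (j : 'I_n) := ballot_poly n v.*2 j.
have -> : Dmx n m ((v + m)%:R : F) =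
  diag_mx r *m (\matrix_(i, j) (p j).[x 0 i + m%:R]) *m diag_mx c.
  apply/matrixP=> i j; rewrite Dmx_entry_nat mul_mx_diag mul_diag_mx !mxE.
  by rewrite natrD mulrA.
rewrite !det_mulmx !det_diag det_horner_translate; last first.
  by move=> j; apply: size_ballot_poly.
(* After translation the points are [0, ..., n - 1], and [p_j] vanishes at every [i < j]. *)
rewrite det_trig; last first.
  apply/is_trig_mxP => i j ltij; rewrite !mxE horner_ballot_poly //.
  by rewrite prod_nat_sub_eq0 ?mul0r.
rewrite -!big_split big_mkord /=; apply: eq_bigr => i _; rewrite !mxE.
rewrite horner_ballot_poly //.
have -> : \prod_(0 <= s < i) (i%:R - s%:R) = i`!%:R / 0`!%:R :> F.
  by rewrite -[in RHS](addn0 i) -prod_nat_sub addn0.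
have -> : (v.*2 + i + i = v.*2 + i.*2)%N by lia.
(* The column factor cancels the top factor of [(2v + 2i + 1)!]. *)
rewrite factS natrM -!mulrA; congr (_ * _); congr (_ * _).
have f0 := natr_fact_neq0; have s0 : (v.*2 + i.*2).+1%:R != 0 :> F.
  by rewrite Num.Theory.pnatr_eq0.
by move: _.+1%:R s0 => s s0; rewrite fact0; field; rewrite !f0 s0.
Qed.

Lemma prod_fact_double_range (n w : nat) :
  \prod_(0 <= i < n)
    ((w + i)`!%:R * (w + i + n)`!%:R /
     ((w + i.*2)`!%:R * (w + i.*2).+1`!%:R)) = 1 :> F.
Proof.
rewrite big_split prodfV /=.
under eq_bigr do rewrite -addnA.
under [X in _ / X]eq_bigr do rewrite -addnS.
rewrite (prod_double_range n (fun k => (w + k)`!%:R)) divff //.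
by rewrite prodf_seq_neq0; apply/allP=> i _; rewrite mulf_neq0 ?natr_fact_neq0.
Qed.

(** Here [a + b = 2v + m], so [j <= m] and [i >= 1] make both factors positive integers. *)
Lemma factor_den_nat_neq0 (m v i j : nat) :
  (1 <= i)%N -> (1 <= j <= m)%N ->
  factor_den ((v + m)%:R : F) ((v + m)%:R - m%:R) i j != 0.
Proof.
move=> i1 /andP[j1 jm]; rewrite /factor_den -natrB ?leq_addl // addnK.
rewrite -natrM -!natrD -natrB; last by lia.
rewrite -[1]/(1%:R) -natrB; last by lia.
by rewrite -natrM Num.Theory.pnatr_eq0; nia.
Qed.

(** As [j] varies, each of the four linear factors runs through [m] consecutive integers, so its
    product is a quotient of two factorials. *)
Lemma prod_factor_nat (m v i : nat) :
  \prod_(1 <= j < m.+1)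
    (factor_num ((v + m)%:R : F) ((v + m)%:R - m%:R) i.+1 j /
     factor_den ((v + m)%:R : F) ((v + m)%:R - m%:R) i.+1 j) =
  (m + (v.*2 + i))`!%:R / (v.*2 + i)`!%:R *
  ((v.*2 + m.*2 + i.*2)`!%:R / (v.*2 + m + i.*2)`!%:R) /
  ((m + (v.*2 + i.*2).+1)`!%:R / (v.*2 + i.*2).+1`!%:R *
   ((i + m)`!%:R / i`!%:R)).
Proof.
have up (c : nat) : \prod_(0 <= t < m) (c + t).+1%:R = (c + m)`!%:R / c`!%:R :> F.
  by have := prod_nat_shift c 0 m; rewrite !addn0.
have -> : (v.*2 + m.*2 + i.*2 = v.*2 + m + i.*2 + m)%N by lia.
rewrite big_add1 /= -!prod_nat_sub -!up.
rewrite -!big_split -prodfV -big_split /=; apply: eq_bigr => j _.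
rewrite /factor_num /factor_den.
by rewrite -!addnn; congr (_ * _ / (_ * _)); ring.
Qed.

Lemma det_formula_nat (n m v : nat) : det_formula n m ((v + m)%:R : F).
Proof.
rewrite /det_formula /= det_Dmx_nat big_add1 /=.
under [RHS]eq_bigr do rewrite prod_factor_nat.
(* The two products over [i] do not match term by term. They do once the right side is multiplied by
   [prod_fact_double_range] at [w = 2v] and divided by it at [w = 2v + m]. *)
set B := (RHS); rewrite -[B]mulr1 -[B * 1]divr1.
rewrite -[X in B * X](prod_fact_double_range n v.*2).
rewrite -[X in _ / X](prod_fact_double_range n (v.*2 + m)) {}/B.
rewrite -prodfV -!big_split /=; apply: eq_bigr => i _.
have -> : (m + (v.*2 + i) = v.*2 + m + i)%N by lia.
have -> : (m + (v.*2 + i.*2).+1 = (v.*2 + m + i.*2).+1)%N by lia.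
by field; rewrite !natr_fact_neq0.
Qed.

End NaturalParameter.

(** * The identity over [{poly K}] and its specializations *)

Section PolynomialIdentity.
Variable K : numFieldType.

(** [gbinom] divides in a field; here [k!] is inverted among the constants, which keeps the entries
    polynomial. *)
Definition binom_poly (z : {poly K}) (k : int) : {poly K} :=
  match k with
  | Posz k' => (\prod_(0 <= t < k') (z - t%:R)) * (k'`!%:R^-1)%:P
  | Negz _ => 0
  end.

Definition D_poly (n m : nat) : 'M[{poly K}]_n :=
  \matrix_(i < n, j < n)
    (binom_poly (2 * i%:R + 2 * 'X) (i%:Z - j%:Z + m%:Z)
     - binom_poly (2 * i%:R + 2 * 'X) (i%:Z - j%:Z + m%:Z - 1)).

Definition num_poly (m i j : nat) : {poly K} :=
  ('X + ('X - m%:R) + i%:R - j%:R) * ('X + ('X - m%:R) + 2 * i%:R + j%:R - 2).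

Definition den_poly (m i j : nat) : {poly K} :=
  ('X + ('X - m%:R) + 2 * i%:R - j%:R) * (i%:R + j%:R - 1).

Section Specialization.
Variables (G : fieldType) (phi : {rmorphism {poly K} -> G}).

Lemma rmorph_binom_poly z k : phi (binom_poly z k) = gbinom (phi z) k.
Proof.
case: k => [k|k] /=; last by rewrite rmorph0.
rewrite rmorphM rmorph_prod; congr (_ * _).
  by apply: eq_bigr => t _; rewrite rmorphB rmorph_nat.
(* The image of a unit is a unit, so [k!] is nonzero in [G]. *)
have : phi (k`!%:R^-1)%:P * k`!%:R = 1.
  rewrite -(rmorph_nat phi) -rmorphM -polyC_natr -polyCM mulVf ?rmorph1 //.
  exact: natr_fact_neq0.
move=> eq1; rewrite -[RHS]mul1r; apply: (canRL (mulfK _)) => //.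
by apply/eqP=> k0; move/eqP: eq1; rewrite k0 mulr0 eq_sym oner_eq0.
Qed.

Lemma rmorph_det_D_poly n m : phi (\det (D_poly n m)) = \det (Dmx n m (phi 'X)).
Proof.
rewrite -det_map_mx; congr (\det _); apply/matrixP=> i j; rewrite !mxE.
by rewrite rmorphB !rmorph_binom_poly rmorphD !rmorphM !rmorph_nat.
Qed.

Lemma rmorph_num_poly m i j :
  phi (num_poly m i j) = factor_num (phi 'X) (phi 'X - m%:R) i j.
Proof. by rewrite !(rmorphM, rmorphB, rmorphD, rmorph_nat, rmorph1). Qed.

Lemma rmorph_den_poly m i j :
  phi (den_poly m i j) = factor_den (phi 'X) (phi 'X - m%:R) i j.
Proof. by rewrite !(rmorphM, rmorphB, rmorphD, rmorph_nat, rmorph1). Qed.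

(** Used forwards at natural points to obtain the polynomial identity, and backwards to specialize
    that identity. *)
Lemma det_formula_clear_den n m :
  (forall i j, (1 <= i <= n)%N -> (1 <= j <= m)%N -> phi (den_poly m i j) != 0) ->
  det_formula n m (phi 'X) <->
  phi (\det (D_poly n m) *
       \prod_(1 <= i < n.+1) \prod_(1 <= j < m.+1) den_poly m i j) =
  phi (\prod_(1 <= i < n.+1) \prod_(1 <= j < m.+1) num_poly m i j).
Proof.
move=> den_neq0; pose B := \prod_(1 <= i < n.+1) \prod_(1 <= j < m.+1)
  factor_den (phi 'X) (phi 'X - m%:R) i j.
have B_neq0 : B != 0.
  rewrite prodf_seq_neq0; apply/allP=> i; rewrite mem_index_iota => hi /=.
  rewrite prodf_seq_neq0; apply/allP=> j; rewrite mem_index_iota => hj /=.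
  by rewrite -rmorph_den_poly den_neq0.
have phi_prod (f : nat -> nat -> {poly K}) :
    phi (\prod_(1 <= i < n.+1) \prod_(1 <= j < m.+1) f i j) =
    \prod_(1 <= i < n.+1) \prod_(1 <= j < m.+1) phi (f i j).
  by rewrite rmorph_prod; apply: eq_bigr => i _; rewrite rmorph_prod.
rewrite /det_formula rmorphM !phi_prod rmorph_det_D_poly.
under eq_bigr => i _ do rewrite big_split prodfV.
rewrite big_split prodfV -/B /=.
under [X in _ <-> _ * X = _]eq_bigr => i _ do
  under eq_bigr => j _ do rewrite rmorph_den_poly.
under [X in _ <-> _ = X]eq_bigr => i _ do
  under eq_bigr => j _ do rewrite rmorph_num_poly.
by rewrite -/B; split=> [->|<-]; rewrite ?divfK ?mulfK.
Qed.

End Specialization.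

Lemma poly_eq_nat_shift (p q : {poly K}) (m : nat) :
  (forall v : nat, p.[(v + m)%:R] = q.[(v + m)%:R]) -> p = q.
Proof.
move=> eq_pq; apply/eqP; rewrite -subr_eq0; apply/eqP.
(* A nonzero polynomial has fewer roots than its size; these points are distinct in characteristic
   0. *)
pose rs : seq K := [seq (v + m)%:R | v <- iota 0 (size (p - q))].
apply: (@roots_geq_poly_eq0 _ _ rs).
- by apply/allP=> _ /mapP[v _ ->]; rewrite rootE !hornerE eq_pq subrr.
- rewrite map_inj_uniq ?iota_uniq // => u v /eqP.
  by rewrite Num.Theory.eqr_nat eqn_add2r => /eqP.
- by rewrite size_map size_iota.
Qed.

Lemma horner_den_poly_nat_neq0 (m v i j : nat) :
  (1 <= i)%N -> (1 <= j <= m)%N -> horner_eval (v + m)%:R (den_poly m i j) != 0.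
Proof.
move=> hi hj; rewrite rmorph_den_poly /= /horner_eval hornerX.
exact: factor_den_nat_neq0.
Qed.

Lemma det_D_poly (n m : nat) :
  \det (D_poly n m) *
    \prod_(1 <= i < n.+1) \prod_(1 <= j < m.+1) den_poly m i j =
  \prod_(1 <= i < n.+1) \prod_(1 <= j < m.+1) num_poly m i j.
Proof.
apply: (@poly_eq_nat_shift _ _ m) => v.
apply: (det_formula_clear_den (phi := horner_eval (v + m)%:R) _).1.
  by move=> i j /andP[hi _] hj; apply: horner_den_poly_nat_neq0.
by rewrite /= /horner_eval hornerX; apply: det_formula_nat.
Qed.

Lemma det_formula_rmorph (G : fieldType) (phi : {rmorphism {poly K} -> G})
    (n m : nat) :
  (forall i j, (1 <= i <= n)%N -> (1 <= j <= m)%N -> phi (den_poly m i j) != 0) ->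
  det_formula n m (phi 'X).
Proof.
by move=> den_neq0; apply/(det_formula_clear_den den_neq0); rewrite det_D_poly.
Qed.

Lemma den_poly_neq0 (m i j : nat) :
  (1 <= i)%N -> (1 <= j <= m)%N -> den_poly m i j != 0.
Proof.
(* The value at the point [m], that is [v = 0], is already nonzero. *)
move=> hi hj; apply: contraNneq (@horner_den_poly_nat_neq0 m 0 i j hi hj) => ->.
by rewrite rmorph0.
Qed.

End PolynomialIdentity.

Theorem theorem1 (R : realType) (n m : nat) (hn : (1 <= n)%N) :
  det_formula n m (ratfun_var R[i]) /\
  (forall a : R[i],
     (forall i j : nat, (1 <= i <= n)%N -> (1 <= j <= m)%N ->
        factor_den a (a - m%:R) i j != 0) ->
     det_formula n m a).
Proof.
split.
  (* The indeterminate case is the embedding into the fraction field, which is injective; the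
     numerical case below is evaluation at [a]. *)
  apply: (det_formula_rmorph (phi := @tofrac {poly R[i]})).
  by move=> i j /andP[hi _] hj; rewrite tofrac_eq0 den_poly_neq0.
move=> a den_neq0; rewrite -[a]hornerX.
apply: (det_formula_rmorph (phi := horner_eval a)) => i j hi hj.
by rewrite rmorph_den_poly /= /horner_eval hornerX den_neq0.
Qed.
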